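(* Let $\mathfrak{sl}_3(\mathbf{C})$ act on $V = \mathrm{Sym}^k \mathbf{C}^3$ and let $U = \mathrm{Sym}^k X$ for a plane (two-dimensional linear subspace) $X \leq \mathbf{C}^3$. Then $$\mathrm{diam}_+^{\mathfrak{sl}_3(\mathbf{C}),\mathrm{mon}}(V, U) = \Bigl\lceil \frac{k+2}{2} \Bigr\rceil$$ for every $k \geq 1$, and in a basis $e_1,e_2,e_3$ of $\mathbf{C}^3$ with $X = \langle e_1, e_2\rangle$ the bound is attained by monomials whose factors are all of the form $\alpha E_{21} + \beta E_{32}$ with $\alpha,\beta \in \mathbf{C}$ (depending on the factor).
   Context: Let $\mathfrak{g}$ be a Lie algebra with a representation $\rho$ on a finite-dimensional complex vector space $V$. A monomial is an operator $\rho(x_1)\rho(x_2)\cdots\rho(x_r)$ on $V$ with $r \geq 0$ and $x_1,\dots,x_r \in \mathfrak{g}$, the identity operator being the empty product ($r=0$); the $x_i$ are its factors. The set of monomials is denoted $\mathrm{mon}(\rho(\mathfrak{g}))$. The monomial Lie-additive diameter of $V$ with respect to a nonzero subspace $U \leq V$ is $$\mathrm{diam}_+^{\mathfrak{g},\mathrm{mon}}(V,U) = \min\{ d \mid m_1\cdot U + \cdots + m_d\cdot U = V \text{ for some } m_1,\dots,m_d \in \mathrm{mon}(\rho(\mathfrak{g}))\}.$$ The action of $\mathfrak{sl}_3(\mathbf{C})$ on $\mathrm{Sym}^k\mathbf{C}^3$ is the one induced from the natural action on $\mathbf{C}^3$ (by derivations), and $E_{ij}$ denotes the matrix unit with $E_{ij}e_j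 = e_i$, so that identifying $V$ with homogeneous polynomials of degree $k$ in $e_1,e_2,e_3$, $E_{ij}$ acts as $e_i\,\partial/\partial e_j$. *)

(* Defs.v *)
From HB Require Import structures.
From mathcomp Require Import all_boot all_order all_algebra.
From mathcomp Require Import complex.
From mathcomp Require Import reals.
From mathcomp Require Import mpoly.

Set Implicit Arguments.
Unset Strict Implicit.
Unset Printing Implicit Defensive.

Import GRing.Theory.
Local Open Scope ring_scope.

(* Monomials and the diameter depend on the Lie algebra g only through the
   image of rho, so g is a bare type in this section. *)
Section Diameter.
Variables (F : fieldType) (g : Type) (V : vectType F) (rho : g -> 'End(V)).

(* rho(x_1) o ... o rho(x_r) for s = [:: x_1; ...; x_r] *)
Definition mon_of (s : seq g) : 'End(V) :=
  foldr (fun x f => (rho x \o f)%VF) \1%VF s.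

Definition is_monomial (m : 'End(V)) : Prop := exists s : seq g, m = mon_of s.

Definition fills (U : {vspace V}) (d : nat) (m : 'I_d -> 'End(V)) : Prop :=
  (\sum_(i < d) (m i @: U))%VS = fullv.

Definition mon_fillable (U : {vspace V}) (d : nat) : Prop :=
  exists m : 'I_d -> 'End(V), (forall i, is_monomial (m i)) /\ fills U m.

(* diam_+^{g,mon}(V, U) = d : the minimum exists and is d *)
Definition mon_diam_is (U : {vspace V}) (d : nat) : Prop :=
  mon_fillable U d /\ (forall d', mon_fillable U d' -> (d <= d')%N).

End Diameter.

Section SpecialLinear.
Variables (F : fieldType) (n : nat).

Definition sl : {vspace 'M[F]_n} := lker (linfun (fun A : 'M[F]_n => \tr A : F^o)).

Lemma mem_sl (A : 'M[F]_n) : (A \in sl) = (\tr A == 0).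
Proof.
pose f : {linear 'M[F]_n -> F^o} := @mxtrace F n.
by rewrite memv_ker -[linfun _]/(linfun f) lfunE.
Qed.

Lemma sl_bracket (A B : 'M[F]_n) : A *m B - B *m A \in sl.
Proof. by rewrite mem_sl linearB /= mxtrace_mulC subrr. Qed.

End SpecialLinear.

(* Sym^k F^n is the space dhomog n F k of homogeneous polynomials of degree k
   in 'X_0, ..., 'X_(n-1), a vector v of F^n being the linear form lform v. *)
Section SymmetricPower.
Variables (F : fieldType) (n : nat).
Implicit Types (A B : 'M[F]_n) (p q : {mpoly F[n]}) (v : 'cV[F]_n).

Definition lform v : {mpoly F[n]} := \sum_(i < n) v i 0 *: 'X_i.

Lemma lform_linear : linear lform.
Proof.
move=> a u v; rewrite /lform scaler_sumr -big_split /=.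
by apply: eq_bigr => i _; rewrite !mxE scalerDl scalerA.
Qed.

HB.instance Definition _ :=
  GRing.isLinear.Build F 'cV[F]_n {mpoly F[n]} _ lform lform_linear.

Lemma lform_homog v : lform v \is 1.-homog.
Proof. by apply: rpred_sum => i _; apply: rpredZ; rewrite dhomogX /= mdeg1. Qed.

(* The matrix unit E_ij acts as 'X_i d/d'X_j. *)
Definition gl_der A p : {mpoly F[n]} :=
  \sum_(i < n) \sum_(j < n) A i j *: ('X_i * p^`M(j)).

Lemma gl_der_linear A : linear (gl_der A).
Proof.
move=> a p q; rewrite /gl_der scaler_sumr -big_split /=.
apply: eq_bigr => i _; rewrite scaler_sumr -big_split /=.
apply: eq_bigr => j _.
by rewrite linearP /= mulrDr -scalerAr scalerDr !scalerA mulrC.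
Qed.

HB.instance Definition _ A :=
  GRing.isLinear.Build F {mpoly F[n]} {mpoly F[n]} _ (gl_der A)
    (gl_der_linear A).

Lemma gl_derE A p : gl_der A p = \sum_(j < n) lform (col j A) * p^`M(j).
Proof.
rewrite /gl_der exchange_big /=; apply: eq_bigr => j _.
rewrite mulr_suml; apply: eq_bigr => i _.
by rewrite mxE scalerAl.
Qed.

Lemma gl_derM A p q : gl_der A (p * q) = gl_der A p * q + p * gl_der A q.
Proof.
rewrite !gl_derE mulr_suml mulr_sumr -big_split /=; apply: eq_bigr => j _.
by rewrite mderivM mulrDr; congr (_ + _); [rewrite mulrA | rewrite mulrCA].
Qed.

Lemma gl_der_lform A v : gl_der A (lform v) = lform (A *m v).
Proof.
have dX (i j : 'I_n) : mderiv j ('X_i : {mpoly F[n]}) = (i == j)%:R.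
  rewrite mderivX mnm1E; case: eqP => [->|_]; last by rewrite scale0r.
  by rewrite scale1r -{1}[U_(j)%MM]add0m addmK mpolyX0.
rewrite gl_derE.
have -> : A *m v = \sum_(j < n) v j 0 *: col j A.
  apply/colP => i; rewrite summxE !mxE.
  by apply: eq_bigr => j _; rewrite !mxE mulrC.
rewrite linear_sum; apply: eq_bigr => j _.
rewrite linearZ /= raddf_sum (bigD1 j) //= big1 => [|l lj].
  by rewrite addr0 linearZ /= dX eqxx -scalerAr mulr1.
by rewrite linearZ /= dX (negbTE lj) scaler0.
Qed.

Lemma gl_der_homog k A p : p \is k.-homog -> gl_der A p \is k.-homog.
Proof.
move=> hp; rewrite [p]mpolyE linear_sum big_seq; apply: rpred_sum => m mp.
have dm : mdeg m = k := dhomog_mf hp mp.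
rewrite linearZ; apply: rpredZ; apply: rpred_sum => i _.
apply: rpred_sum => j _; apply: rpredZ; rewrite mderivX -scalerAr.
have [->|mj] := eqVneq (m j) 0%N; first by rewrite scale0r rpred0.
have lejm : (U_(j) <= m)%MM.
  by apply/mnm_lepP => l; rewrite mnm1E; case: eqP => // <-; rewrite lt0n.
apply: rpredZ; rewrite -mpolyXD dhomogX /= -dm -{2}(submK lejm).
by rewrite !mdegD !mdeg1 addnC.
Qed.

Lemma gl_der_bracket A B p :
  gl_der (A *m B - B *m A) p = gl_der A (gl_der B p) - gl_der B (gl_der A p).
Proof.
have comp M N : gl_der M (gl_der N p) = gl_der (M *m N) p
    + \sum_(j < n) \sum_(l < n) lform (col j N) * lform (col l M) * p^`M(j)^`M(l).
  rewrite [gl_der N p]gl_derE linear_sum /= [in RHS]gl_derE -big_split /=.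
  apply: eq_bigr => j _; rewrite gl_derM gl_der_lform.
  congr (_ + _); first by rewrite !colE mulmxA.
  by rewrite gl_derE mulr_sumr; apply: eq_bigr => l _; rewrite mulrA.
rewrite !comp [X in _ = _ - (_ + X)]exchange_big /=.
have -> : gl_der (A *m B - B *m A) p = gl_der (A *m B) p - gl_der (B *m A) p.
  rewrite !gl_derE -sumrB; apply: eq_bigr => j _.
  by rewrite -mulrBl -linearB /= linearB.
rewrite opprD addrACA; rewrite -[LHS]addr0; congr (_ + _).
apply/esym/eqP; rewrite subr_eq0; apply/eqP.
apply: eq_bigr => j _; apply: eq_bigr => l _.
by rewrite mderiv_comm [lform _ * lform _]mulrC.
Qed.

End SymmetricPower.

Section SymRepresentation.
Variables (F : fieldType) (n k : nat).
Implicit Types (A B : 'M[F]_n.+1) (X : {vspace 'cV[F]_n.+1}).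
Local Notation Symk := (dhomog n.+1 F k).

Definition sym_der A (p : Symk) : Symk :=
  DHomog (gl_der_homog A (dhomog_is_dhomog p)).

Lemma sym_der_linear A : linear (sym_der A).
Proof. by move=> a p q; apply/val_inj; rewrite /= linearP. Qed.

HB.instance Definition _ A :=
  GRing.isLinear.Build F Symk Symk _ (sym_der A) (sym_der_linear A).

Definition gl_sym A : 'End(Symk) := linfun (sym_der A).

Lemma gl_symE A (p : Symk) : val (gl_sym A p) = gl_der A (val p).
Proof. by rewrite lfunE. Qed.

Lemma gl_sym_linear : linear gl_sym.
Proof.
move=> a A B; apply/lfunP => p; apply/val_inj.
rewrite add_lfunE scale_lfunE linearD linearZ /= !gl_symE !gl_derE.
rewrite scaler_sumr -big_split; apply: eq_bigr => j _ /=.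
by rewrite scalerAl -mulrDl !linearP.
Qed.

Lemma gl_sym_bracket A B :
  gl_sym (A *m B - B *m A) =
  (gl_sym A \o gl_sym B)%VF - (gl_sym B \o gl_sym A)%VF.
Proof.
apply/lfunP => p; apply/val_inj.
by rewrite add_lfunE opp_lfunE !comp_lfunE linearB /= !gl_symE gl_der_bracket.
Qed.

Definition sl_sym (x : subvs_of (sl F n.+1)) : 'End(Symk) := gl_sym (vsval x).

Lemma lform_prod_homog (x : 'I_k -> 'cV[F]_n.+1) :
  \prod_(i < k) lform (x i) \is k.-homog.
Proof.
elim: k x => [|d IH] x; first by rewrite big_ord0 dhomog1.
by rewrite big_ord_recl; exact: (dhomogM (lform_homog _) (IH _)).
Qed.

(* x_1 x_2 ... x_k in Sym^k *)
Definition sym_prod (x : 'I_k -> 'cV[F]_n.+1) : Symk :=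
  DHomog (lform_prod_homog x).

(* The subspace Sym^k X, spanned by the products of elements of a basis of X;
   by mem_symv it contains every product of k vectors of X. *)
Definition symv X : {vspace Symk} :=
  <<[seq sym_prod (fun i => (vbasis X)`_(t i))
      | t : {ffun 'I_k -> 'I_(\dim X)}]>>%VS.

Lemma mem_symv X (x : 'I_k -> 'cV[F]_n.+1) :
  (forall i, x i \in X) -> sym_prod x \in symv X.
Proof.
move=> xX.
pose c i (j : 'I_(\dim X)) := coord (vbasis X) j (x i).
have -> : sym_prod x = \sum_(t : {ffun 'I_k -> 'I_(\dim X)})
    (\prod_(i < k) c i (t i)) *: sym_prod (fun i => (vbasis X)`_(t i)).
  apply/val_inj; rewrite raddf_sum /=.
  transitivity (\prod_(i < k) \sum_(j < \dim X) c i j *: lform (vbasis X)`_j).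
    apply: eq_bigr => i _; rewrite {1}(coord_vbasis (xX i)) linear_sum.
    by apply: eq_bigr => j _; rewrite linearZ.
  by rewrite bigA_distr_bigA; apply: eq_bigr => t _; rewrite scaler_prod.
apply: memv_suml => t _; apply: memvZ; apply: memv_span.
by apply/mapP; exists t; rewrite ?mem_enum.
Qed.

End SymRepresentation.

(* E_ij with respect to a basis e: the matrix of v |-> (e_j-coordinate of v) e_i
   (indices start at 0). *)
Definition munit (F : fieldType) (n : nat) (e : n.-tuple 'cV[F]_n)
    (i j : 'I_n) : 'M[F]_n :=
  \matrix_(a, b) (coord e j (delta_mx b 0) * e`_i a 0).

Lemma munitE (F : fieldType) (n : nat) (e : n.-tuple 'cV[F]_n) (i j l : 'I_n) :
  basis_of fullv e -> munit e i j *m e`_l = (l == j)%:R *: e`_i.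
Proof.
move=> /basis_free fe; rewrite -(coord_free l j fe).
rewrite {2}[e`_l]matrix_sum_delta linear_sum; apply/colP => a.
rewrite !mxE mulr_suml; apply: eq_bigr => b _.
by rewrite big_ord1 linearZ mxE /= mulrC mulrA.
Qed.

(* Main.v *)
Require Import Defs.
From mathcomp Require Import all_boot all_order all_algebra.
From mathcomp Require Import complex.
From mathcomp Require Import reals.
From mathcomp Require Import mpoly.
From mathcomp Require Import zify.

(** Put x, y, z for the linear forms of a basis e_1, e_2, e_3 with X spanned by
    e_1 and e_2, so that Sym^k X has the basis x^a y^(k-a).

    Lower bound: a linear map does not increase dimension, so d monomials reach
    a subspace of dimension at most d (k+1), whereas Sym^k C^3 has dimension
    (k+1)(k+2)/2.

    Upper bound: let D_s = E_21 + s E_32, that is x -> y -> s z -> 0.  The j-th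
    monomial (0 <= j < d) is D_s^r with s = s_j generic and r = min(2j, k).
    Give x, y, z the weights 1, 0, -1; D_s lowers the weight by 1, so the
    question splits into one question per weight.  The weight space of weight w
    consists of the monomials x^(p0+i) y^* z^(q0+i), where p0 - q0 = w and one
    of p0, q0 is 0.  The exponents 0, 2, 4, ... are chosen so that each weight
    space receives enough vectors: those of the indices j = j0 + i, where
    j0 = ceil(q0/2) and i runs over the indices of its monomials, are used.  In
    these vectors the monomial with z^c has as coefficient s_j^c times a natural
    number, a weighted count of the words in E_21 and E_32 with c letters E_32
    (iter_gl_der), and this number is positive on the diagonal (word_coef_gt0).

    The determinant of the square system of a weight is therefore a polynomial
    in the s_j whose top coefficient with respect to the last of them is a
    nonzero multiple of the determinant of the system with one row and column
    less.  So finitely many such determinants are simultaneously nonzero for a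
    suitable sequence s (generic_scaling), and then every monomial in x, y, z
    is reached. *)

Set Implicit Arguments.
Unset Strict Implicit.
Unset Printing Implicit Defensive.

Import GRing.Theory Num.Theory.
Local Open Scope ring_scope.

(** * Generic row scalings of matrices *)

Definition scaled_mx (F : fieldType) (N : nat -> nat -> F) (q : nat)
    (s : nat -> F) (n : nat) : 'M[F]_n :=
  \matrix_(i, j) (N i j * s i ^+ (q + j)).

Lemma eq_scaled_mx (F : fieldType) (N : nat -> nat -> F) q (s s' : nat -> F) n :
  (forall i, (i < n)%N -> s i = s' i) -> scaled_mx N q s n = scaled_mx N q s' n.
Proof. by move=> ss'; apply/matrixP => i j; rewrite !mxE ss'. Qed.

Section GenericScaling.
Variable F : fieldType.
Implicit Types (N : nat -> nat -> F) (s : nat -> F).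

(** The Laplace expansion along the last row, the scaling of that row being the
    indeterminate: the cofactors do not involve [s n]. *)
Definition last_row_poly N q s n : {poly F} :=
  \sum_(j < n.+1)
     (N n j * cofactor (scaled_mx N q s n.+1) ord_max j) *: 'X^(q + j).

Lemma last_row_polyE N q s n x :
  (last_row_poly N q s n).[x] =
  \det (scaled_mx N q (fun i => if i == n then x else s i) n.+1).
Proof.
rewrite (expand_det_row _ ord_max) horner_sum; apply: eq_bigr => j _.
rewrite hornerZ hornerXn mxE eqxx mulrAC; congr (_ * _).
rewrite /cofactor; congr (_ * \det _); apply/matrixP => a b; rewrite !mxE.
by rewrite lift_max ltn_eqF.
Qed.

(** The term of highest degree comes from the last column only, and its cofactor
    is the leading principal minor. *)
Lemma last_row_poly_neq0 N q s n :
  N n n != 0 -> \det (scaled_mx N q s n) != 0 -> last_row_poly N q s n != 0.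
Proof.
move=> Nn dn; apply/eqP => /(congr1 (coefp (q + n))) /eqP.
rewrite /= coef0 coef_sum (bigD1 ord_max) //= big1 => [|j jn]; last first.
  rewrite coefZ coefXn eqn_add2l; case: eqP => [nj|_]; last by rewrite mulr0.
  by case/eqP: jn; apply/val_inj.
rewrite coefZ coefXn eqxx mulr1 addr0 mulf_eq0 (negPf Nn) /=.
rewrite /cofactor mulf_eq0 signr_eq0 /=; apply/negP.
suff -> : row' ord_max (col' ord_max (scaled_mx N q s n.+1))
          = scaled_mx N q s n.
  by [].
by apply/matrixP => a b; rewrite !mxE !lift_max.
Qed.

End GenericScaling.

(** One sequence [s] makes finitely many families of matrices invertible, where
    the family [t] reads [s] from the index [o t] on.  The values of [s] are
    chosen one after the other: each family that uses the new value at all uses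
    it in the last row of a single matrix, whose determinant is a nonzero
    polynomial in it because the previous minor is nonzero; the product of these
    polynomials has a nonroot. *)
Lemma generic_scaling (F : closedFieldType) (T : finType)
    (N : T -> nat -> nat -> F) (o q h : T -> nat) :
  (forall t i, (i < h t)%N -> N t i i != 0) ->
  exists s : nat -> F, forall t n, (n <= h t)%N ->
    \det (scaled_mx (N t) (q t) (fun i => s (o t + i)%N) n) != 0.
Proof.
move=> Nd.
suff [s sP] : exists s : nat -> F, forall t n, (n <= h t)%N ->
    (o t + n <= \max_t (o t + h t))%N ->
    \det (scaled_mx (N t) (q t) (fun i => s (o t + i)%N) n) != 0.
  exists s => t n nh; apply: sP => //.
  by apply: leq_trans (leq_bigmax t); rewrite leq_add2l.
move: (\max_t _)%N => K; elim: K => [|K [s sP]].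
  exists (fun=> 0) => t [|n]; first by rewrite det_mx00 oner_eq0.
  by rewrite addnS ltn0.
pose P t : {poly F} := if (o t <= K < o t + h t)%N then
  last_row_poly (N t) (q t) (fun i => s (o t + i)%N) (K - o t) else 1.
have : \prod_t P t != 0.
  apply/prodf_neq0 => t _; rewrite /P.
  case: ifP => [/andP[oK Kh]|_]; last exact: oner_neq0.
  apply: last_row_poly_neq0; first by apply: Nd; lia.
  by apply: sP; lia.
case/closed_nonrootP => x; rewrite /root horner_prod => /prodf_neq0 xP.
exists (fun i => if i == K then x else s i) => t n nh onK.
case: (leqP (o t + n) K) => [onK'|Kon].
  rewrite (@eq_scaled_mx _ _ _ _ (fun i => s (o t + i)%N)); first exact: sP.
  by move=> i ni; case: eqP => //; lia.
case: n nh onK Kon => [|n] nh onK Kon; first by rewrite det_mx00 oner_eq0.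
have En : n = (K - o t)%N by lia.
have := xP t isT; rewrite /P ifT; last by lia.
rewrite -En last_row_polyE.
rewrite (@eq_scaled_mx _ _ _ _
  (fun i => if (o t + i)%N == K then x else s (o t + i)%N)) //.
by move=> i _; have -> : (i == n) = ((o t + i)%N == K) by lia.
Qed.

Lemma memv_unitmx_comb (F : fieldType) (V : vectType F) (W : {vspace V}) n
    (A : 'M[F]_n) (u : 'I_n -> V) :
  A \in unitmx -> (forall i, \sum_j A i j *: u j \in W) -> forall j, u j \in W.
Proof.
move=> Au uW j.
have -> : u j = \sum_i invmx A j i *: (\sum_l A i l *: u l).
  under eq_bigr do rewrite scaler_sumr; rewrite exchange_big /=.
  under eq_bigr => l _.
    under eq_bigr do rewrite scalerA.
    rewrite -scaler_suml.
    have -> : \sum_i invmx A j i * A i l = (invmx A *m A) j l by rewrite mxE.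
    rewrite mulVmx // mxE; over.
  rewrite (bigD1 j) //= eqxx scale1r big1 ?addr0 // => l lj.
  by rewrite eq_sym (negPf lj) scale0r.
by apply: memv_suml => i _; apply: memvZ.
Qed.

(** * The powers of E_21 + s E_32 on x^a y^(k-a) *)

Section WordCoefficients.
Variables k a : nat.

(** The sum, over the words with [r - c] letters E_21 and [c] letters E_32, of
    the coefficient by which the word acts on x^a y^(k-a); the last letter
    applied gives the recursion.  The truncated subtractions are harmless: an
    exponent that would become negative is preceded by a zero factor. *)
Fixpoint word_coef r c : nat :=
  if r is r'.+1 then
    ((a + c - r') * word_coef r' c +
     if c is c'.+1 then (k + r' - a - c'.*2) * word_coef r' c' else 0)%N
  else (c == 0)%N.

Lemma word_coef_eq0 r c :
  (a <= k)%N ->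
  [|| r < c, a + c < r | k + r < a + c.*2]%N -> word_coef r c = 0%N.
Proof.
move=> ak; elim: r c => [|r IH] c /=; first by case: c => //= ?; lia.
move=> H; apply/eqP; rewrite addn_eq0; apply/andP; split.
  have [E|] := eqVneq (a + c - r)%N 0%N; first by rewrite E.
  by move=> ?; rewrite IH ?muln0 //; lia.
case: c H => // c H.
have [E|] := eqVneq (k + r - a - c.*2)%N 0%N; first by rewrite E.
by move=> ?; rewrite IH ?muln0 //; lia.
Qed.

(** All contributions are natural numbers, and under these inequalities the word
    that applies every E_21 before every E_32 does not vanish. *)
Lemma word_coef_gt0 r c :
  (a <= k)%N -> [&& c <= r, r <= a + c & a + c.*2 <= k + r]%N ->
  (0 < word_coef r c)%N.
Proof.
move=> ak; elim: r c => [|r IH] c /=; first by case: c => //= ?; lia.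
move=> H; rewrite addn_gt0.
have [/andP[cr ack]|Hc] := boolP ((c <= r) && (a + c.*2 <= k + r))%N.
  by apply/orP; left; rewrite muln_gt0 IH ?andbT; lia.
case: c H Hc => [|c] H Hc; first by lia.
by apply/orP; right; rewrite muln_gt0 IH ?andbT; lia.
Qed.

End WordCoefficients.

Section Derivation.
Variables (F : fieldType) (n : nat) (M : 'M[F]_n).

Lemma gl_der1 : gl_der M 1 = 0.
Proof.
have /eqP := gl_derM M 1 1.
by rewrite !mul1r mulr1 addrC -subr_eq subrr => /eqP.
Qed.

Lemma gl_derX p r : gl_der M (p ^+ r) = (p ^+ r.-1 * gl_der M p) *+ r.
Proof.
elim: r => [|r IH]; first by rewrite gl_der1 mulr0n.
rewrite exprS gl_derM IH mulrS mulrC; congr (_ + _).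
by case: r {IH} => [|r]; rewrite ?mulr0n ?mulr0 // mulrnAr mulrA -exprS.
Qed.

Variables (x y z : {mpoly F[n]}) (s : F).
Hypotheses (Dx : gl_der M x = y) (Dy : gl_der M y = s *: z).
Hypothesis Dz : gl_der M z = 0.

Lemma gl_der_monom a b c :
  gl_der M (x ^+ a * y ^+ b * z ^+ c) =
  a%:R *: (x ^+ a.-1 * y ^+ b.+1 * z ^+ c)
  + (b%:R * s) *: (x ^+ a * y ^+ b.-1 * z ^+ c.+1).
Proof.
rewrite !gl_derM !gl_derX Dx Dy Dz mulr0 mul0rn mulr0 addr0 mulrDl.
rewrite -!scaler_nat -scalerA; congr (_ + _).
  by rewrite -!scalerAl exprS -!mulrA.
by rewrite -!scalerAr -!scalerAl exprS -!mulrA.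
Qed.

Lemma iter_gl_der k a r : (a <= k)%N ->
  iter r (gl_der M) (x ^+ a * y ^+ (k - a)) =
  \sum_(c < r.+1) ((word_coef k a r c)%:R * s ^+ c) *:
    (x ^+ (a + c - r) * y ^+ (k + r - a - c.*2) * z ^+ c).
Proof.
move=> ak; elim: r => [|r IH].
  by rewrite big_ord1 /= !addn0 !subn0 expr0 !mulr1 scale1r.
rewrite iterS IH linear_sum /=.
pose G c : {mpoly F[n]} :=
  x ^+ (a + c - r.+1) * y ^+ (k + r.+1 - a - c.*2) * z ^+ c.
pose w1 c := ((a + c - r) * word_coef k a r c)%N.
pose w2 c := ((k + r - a - c.*2) * word_coef k a r c)%N.
transitivity (\sum_(c < r.+1) ((w1 c)%:R * s ^+ c) *: G c
            + \sum_(c < r.+1) ((w2 c)%:R * s ^+ c.+1) *: G c.+1).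
  rewrite -big_split /=; apply: eq_bigr => c _.
  rewrite linearZ /= gl_der_monom scalerDr /w1 /w2 !scalerA.
  have [H|H] := boolP [|| r < c, a + c < r | k + r < a + c.*2]%N.
    by rewrite (word_coef_eq0 ak H) !muln0 !mul0r !scale0r.
  rewrite !natrM [s ^+ c.+1]exprS; congr (_ + _).
    rewrite mulrAC [_%:R * _%:R]mulrC.
    have [->|ac] := eqVneq (a + c - r)%N 0%N.
      by rewrite mulr0n ?mulr0 !mul0r !scale0r.
    by rewrite /G; congr (_ *: (_ ^+ _ * _ ^+ _ * _)); lia.
  have [->|bc] := eqVneq (k + r - a - c.*2)%N 0%N.
    by rewrite mulr0n !mul0r mulr0 !scale0r.
  rewrite mulrC mulrACA mulrA; congr (_ *: _).
  by rewrite /G; congr (_ ^+ _ * _ ^+ _ * _); lia.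
have w1r : w1 r.+1 = 0%N by rewrite /w1 word_coef_eq0 ?ltnSn ?muln0.
have -> : \sum_(c < r.+1) ((w1 c)%:R * s ^+ c) *: G c =
          \sum_(c < r.+2) ((w1 c)%:R * s ^+ c) *: G c.
  by rewrite [RHS]big_ord_recr /= w1r mul0r scale0r addr0.
rewrite !(big_ord_recl r.+1) /= -addrA addn0; congr (_ + _).
rewrite -big_split; apply: eq_bigr => c _ /=.
by rewrite -scalerDl -mulrDl -natrD.
Qed.
(** The same expansion, indexed by the monomials of the weight space: [p0] and
    [q0] are the exponents of x and z in the first of them.  A smaller power of
    z would require a negative exponent of x, or of z, because one of [p0], [q0]
    is zero. *)
Lemma iter_gl_der_weight k p0 q0 r (a := (r + p0 - q0)%N) :
  (p0 == 0%N) || (q0 == 0%N) ->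
  (q0 <= r + p0)%N -> (a <= k)%N -> (p0 + q0 <= k)%N ->
  iter r (gl_der M) (x ^+ a * y ^+ (k - a)) =
  \sum_(j < (k - p0 - q0)./2.+1)
    ((word_coef k a r (q0 + j))%:R * s ^+ (q0 + j)) *:
    (x ^+ (p0 + j) * y ^+ (k - p0 - q0 - j.*2) * z ^+ (q0 + j)).
Proof.
move=> pq0 rq ak pqk; rewrite iter_gl_der //; set h := _./2.+1.
pose G (c : nat) : {mpoly F[n]} := ((word_coef k a r c)%:R * s ^+ c) *:
  (x ^+ (a + c - r) * y ^+ (k + r - a - c.*2) * z ^+ c).
have G0 c : [|| r < c, a + c < r | k + r < a + c.*2]%N -> G c = 0.
  by move=> H; rewrite /G word_coef_eq0 // mul0r scale0r.
transitivity (\sum_(j < h) G (q0 + j)%N).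
  transitivity (\sum_(c < r.+1 + (q0 + h)) G c).
    rewrite big_split_ord /= [X in _ + X]big1 ?addr0 // => c _.
    by rewrite G0 //; lia.
  rewrite addnC !big_split_ord /= big1 ?add0r => [|c _]; last first.
    by rewrite G0 //; have := ltn_ord c; lia.
  by rewrite [X in _ + X]big1 ?addr0 // => c _; rewrite G0 //; lia.
apply: eq_bigr => j _; rewrite /G /a.
by congr (_ *: (_ ^+ _ * _ ^+ _ * _)); lia.
Qed.

End Derivation.

(** * The dimension bound *)

(** A total map into the homogeneous polynomials, so that bases can be listed
    without degree proofs; a form of another degree is sent to 0. *)
Definition homog_part (F : fieldType) n k (p : {mpoly F[n]}) : dhomog n F k :=
  DHomog (pihomogP mdeg k p).

Lemma lformX_homog (F : fieldType) n (v : 'cV[F]_n) r :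
  lform v ^+ r \is r.-homog.
Proof. by rewrite -[in r.-homog](mul1n r); apply/dhomogMn/lform_homog. Qed.

Section LowerBound.
Variables (F : fieldType) (k : nat) (X : {vspace 'cV[F]_3}).
Hypothesis dimX : \dim X = 2%N.

Lemma dim_symv : (\dim (symv k X) <= k.+1)%N.
Proof.
pose f j := lform ((vbasis X)`_j).
pose E := [seq homog_part k (f 0%N ^+ j * f 1%N ^+ (k - j)) | j <- iota 0 k.+1].
have -> : k.+1 = size E by rewrite size_map size_iota.
apply: leq_trans (dim_span E); apply: dimvS.
apply/span_subvP => _ /mapP[t _ ->].
pose Z := [pred i : 'I_k | t i == 0%N :> nat].
have cZ : (#|Z| + #|predC Z| = k)%N by rewrite cardC card_ord.
apply: memv_span; apply/mapP; exists #|Z|; first by rewrite mem_iota; lia.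
apply/val_inj => /=.
suff <- : \prod_(i < k) lform (vbasis X)`_(t i)
          = f 0%N ^+ #|Z| * f 1%N ^+ (k - #|Z|).
  by rewrite pihomog_dE // lform_prod_homog.
have -> : (k - #|Z| = #|predC Z|)%N by lia.
rewrite (bigID Z) /=; congr (_ * _).
  by rewrite -prodr_const; apply: eq_bigr => i /eqP ->.
rewrite -prodr_const; apply: eq_bigr => i ti; congr (lform _`_ _).
have := ltn_ord (t i); rewrite [X in (_ < X)%N]dimX; move: ti.
by case: (nat_of_ord (t i)) => [|[]].
Qed.

Lemma leq_dim_fills d (m : 'I_d -> 'End(dhomog 3 F k)) :
  fills (symv k X) m -> (uphalf (k + 2) <= d)%N.
Proof.
move=> fm.
have : (\dim {:dhomog 3 F k} <= d * k.+1)%N.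
  rewrite -fm; apply: leq_trans (dimv_leq_sum _ _ _) _.
  rewrite -[d in (_ <= d * _)%N]card_ord -sum_nat_const; apply: leq_sum => i _.
  apply: leq_trans dim_symv; rewrite -[leqRHS](limg_ker_dim (m i)).
  exact: leq_addl.
have -> : \dim {:dhomog 3 F k} = 'C(k + 2, k) by rewrite dimvf.
rewrite -[leqLHS]bin_sub ?leq_addr // addKn => H.
have := mul_bin_left (k + 2) 1; rewrite bin1 => E; nia.
Qed.
End LowerBound.

(** * Monomials in an arbitrary basis *)

Section Spanning.
Variables (F : fieldType) (k : nat) (e : 3.-tuple 'cV[F]_3).
Hypothesis be : basis_of fullv e.

Definition sym_monom a b c : dhomog 3 F k :=
  homog_part k (lform e`_0 ^+ a * lform e`_1 ^+ b * lform e`_2 ^+ c).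

Lemma sym_monomE a b c : (a + b + c = k)%N ->
  val (sym_monom a b c) = lform e`_0 ^+ a * lform e`_1 ^+ b * lform e`_2 ^+ c.
Proof.
by move=> Ek; rewrite /= pihomog_dE // -[in k.-homog]Ek !dhomogM ?lformX_homog.
Qed.

(** Linear change of variables: substituting the forms [l] of the inverse matrix
    and then the forms [lform e`_j] gives back [p]. *)
Lemma mpoly_lform (p : {mpoly F[3]}) :
  exists q : {mpoly F[3]}, p = \sum_(m <- msupp q)
    q@_m *: (lform e`_0 ^+ m ord0 * lform e`_1 ^+ m (inord 1)
             * lform e`_2 ^+ m (inord 2)).
Proof.
pose l := [tuple \sum_(j < 3)
  coord e j (delta_mx i 0) *: ('X_j : {mpoly F[3]}) | i < 3].
pose w := [tuple lform e`_j | j < 3].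
have lw i : tnth l i \mPo w = 'X_i.
  rewrite tnth_mktuple linear_sum /=.
  transitivity (lform (delta_mx i 0 : 'cV[F]_3)).
    rewrite {2}(coord_basis be (memvf (delta_mx i 0))) linear_sum.
    apply: eq_bigr => j _; rewrite !linearZ /= comp_mpolyXU.
    by rewrite -(tnth_nth 0 w) tnth_mktuple.
  rewrite /lform (bigD1 i) //= big1 => [|j ji]; rewrite mxE.
    by rewrite !eqxx scale1r addr0.
  by rewrite (negPf ji) scale0r.
exists (p \mPo l).
transitivity ((p \mPo l) \mPo w).
  rewrite (comp_mpolyEX p l) linear_sum /= {1}[p]mpolyE; apply: eq_bigr => m _.
  rewrite linearZ /= comp_mpolyX rmorph_prod /= mpolyXE_id; congr (_ *: _).
  apply: eq_bigr => i _.
  by rewrite rmorphXn /= lw.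
rewrite comp_mpolyEX; apply: eq_bigr => m _.
rewrite comp_mpolyX !big_ord_recl big_ord0 mulr1 !tnth_mktuple mulrA.
congr (_ *: (_ * _ ^+ m _ * _ ^+ m _)); apply/val_inj; rewrite /= ?inordK //.
Qed.

Lemma fullv_sym_monom (W : {vspace dhomog 3 F k}) :
  (forall a b c, (a + b + c = k)%N -> sym_monom a b c \in W) -> W = fullv.
Proof.
move=> SW; apply/eqP; rewrite eqEsubv subvf; apply/subvP => p _.
have [q Ep] := mpoly_lform (val p).
pose M (m : 'X_{1..3}) := sym_monom (m ord0) (m (inord 1)) (m (inord 2)).
have -> : p = \sum_(m <- msupp q) q@_m *: M m.
  apply/val_inj; rewrite raddf_sum /= -[LHS](pihomog_dE (dhomog_is_dhomog p)).
  by rewrite Ep linear_sum; apply: eq_bigr => m _; rewrite !linearZ.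
elim/big_ind: _ => [|u v|m _]; first exact: mem0v; first exact: memvD.
pose d := (m ord0 + m (inord 1) + m (inord 2))%N.
apply: memvZ; have [dk|/eqP dk] := eqVneq d k.
  exact: SW.
suff -> : M m = 0 by exact: mem0v.
apply/val_inj; rewrite /=; apply: (pihomog_ne0 (d := d)); last first.
  by rewrite !dhomogM ?lformX_homog.
exact/eqP.
Qed.
End Spanning.

(** * Filling by the powers of E_21 + s E_32 *)

Lemma trace_munit (F : fieldType) n (e : n.-tuple 'cV[F]_n) (i j : 'I_n) :
  basis_of fullv e -> \tr (munit e i j) = (i == j)%:R.
Proof.
move=> be; rewrite -(coord_free i j (basis_free be)).
rewrite [e`_i]matrix_sum_delta linear_sum; apply: eq_bigr => a _.
by rewrite mxE big_ord1 linearZ mulrC.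
Qed.

Lemma val_mon_of_nseq (F : fieldType) n k (x : subvs_of (sl F n.+1)) r
    (p : dhomog n.+1 F k) :
  val (mon_of (@sl_sym F n k) (nseq r x) p) = iter r (gl_der (vsval x)) (val p).
Proof.
elim: r => [|r IH] /=; first by rewrite id_lfunE.
by rewrite comp_lfunE gl_symE IH.
Qed.

Section Filling.
Variables (F : numClosedFieldType) (k : nat) (e : 3.-tuple 'cV[F]_3).
Hypothesis be : basis_of fullv e.

Definition lower s : 'M[F]_3 :=
  1 *: munit e (inord 1) (inord 0) + s *: munit e (inord 2) (inord 1).

Lemma lower_sl s : lower s \in sl F 3.
Proof.
rewrite mem_sl linearD /= !linearZ /= !trace_munit // -!val_eqE /= !inordK //.
by rewrite !mulr0 addr0.
Qed.

Lemma lower_lform s :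
  [/\ gl_der (lower s) (lform e`_0) = lform e`_1,
      gl_der (lower s) (lform e`_1) = s *: lform e`_2
    & gl_der (lower s) (lform e`_2) = 0].
Proof.
have L (l : 'I_3) : lower s *m e`_l = (l == 0 :> nat)%:R *: e`_1
     + (s * (l == 1 :> nat)%:R) *: e`_2.
  rewrite mulmxDl -!scalemxAl !munitE // scale1r scalerA.
  by rewrite -!val_eqE /= !inordK.
have {}L l : (l < 3)%N -> gl_der (lower s) (lform e`_l) =
    (l == 0)%:R *: lform e`_1 + (s * (l == 1)%:R) *: lform e`_2.
  by move=> l3; rewrite gl_der_lform (L (Ordinal l3)) linearD !linearZ.
by split; rewrite L //= ?mulr0 ?mulr1 ?scale0r ?scale1r ?add0r ?addr0.
Qed.

(** Increments of 2 match the growth of the weight spaces towards weight 0; the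
    cap at [k] concerns only the last exponent when [k] is odd. *)
Definition word_len j := minn j.*2 k.

(** The conclusion is stated against an arbitrary subspace [W] because the
    powers of [lower (s j)] act on polynomials, not yet on the homogeneous ones
    as a vector space. *)
Lemma lower_fill : exists s : nat -> F, forall W : {vspace dhomog 3 F k},
  (forall j a, (j < uphalf (k + 2))%N -> (a <= k)%N -> forall p,
    val p = iter (word_len j) (gl_der (lower (s j)))
              (lform e`_0 ^+ a * lform e`_1 ^+ (k - a)) -> p \in W) ->
  W = fullv.
Proof.
(* A weight is encoded by the exponents (p, q) of x and z in the first monomial
   of its weight space, so that p = 0 or q = 0; other pairs get size 0. *)
pose T : finType := ('I_k.+1 * 'I_k.+1)%type.
pose ht (p q : nat) := if (((p == 0) || (q == 0)) && (p + q <= k))%N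
  then ((k - p - q)./2.+1)%N else 0%N.
pose rl (q i : nat) := word_len (uphalf q + i).
pose N (p q i j : nat) := word_coef k (rl q i + p - q) (rl q i) (q + j).
have [t i ih|s sP] := @generic_scaling F T
  (fun t i j => (N t.1 t.2 i j)%:R) (fun t => uphalf t.2) (fun t => t.2 : nat)
  (fun t => ht t.1 t.2).
  rewrite /N pnatr_eq0 -lt0n; case: t ih => p0 q0 /=.
  rewrite /ht; case: ifP => // H ih.
  by apply: word_coef_gt0; rewrite /rl /word_len; lia.
exists s => W HW; apply: (fullv_sym_monom be) => a1 a2 a3 Ea.
pose m := minn a1 a3; pose p0 := (a1 - m)%N; pose q0 := (a3 - m)%N.
pose h := ((k - p0 - q0)./2.+1)%N.
have p0k : (p0 < k.+1)%N by lia.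
have q0k : (q0 < k.+1)%N by lia.
have Eh : ht p0 q0 = h by rewrite /ht ifT //; lia.
have := sP (Ordinal p0k, Ordinal q0k) h; rewrite /= Eh => /(_ (leqnn _)).
set A := scaled_mx _ _ _ _ => detA.
have mh : (m < h)%N by lia.
pose u (i : 'I_h) := sym_monom k e (p0 + i) (k - p0 - q0 - i.*2) (q0 + i).
have -> : sym_monom k e a1 a2 a3 = u (Ordinal mh).
  by congr sym_monom => /=; lia.
apply: (memv_unitmx_comb (A := A)) => [|i]; first by rewrite unitmxE unitfE.
have ih := ltn_ord i.
have rq : (q0 <= rl q0 i + p0)%N by rewrite /rl /word_len; lia.
have ak : (rl q0 i + p0 - q0 <= k)%N by rewrite /rl /word_len; lia.
have [Dx Dy Dz] := lower_lform (s (uphalf q0 + i)%N).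
apply: (HW (uphalf q0 + i)%N _ _ ak); first by lia.
rewrite (iter_gl_der_weight Dx Dy Dz _ rq ak); [| by lia | by lia].
rewrite raddf_sum /=; apply: eq_bigr => j _.
have jh := ltn_ord j.
have /= -> := @sym_monomE _ k e (p0 + j) (k - p0 - q0 - j.*2) (q0 + j).
  by rewrite mxE.
by lia.
Qed.

Lemma lower_monomials_fill (X : {vspace 'cV[F]_3}) :
  X = <<[:: e`_0; e`_1]>>%VS ->
  exists s : 'I_(uphalf (k + 2)) -> seq (subvs_of (sl F 3)),
    (forall i, {in s i, forall x, exists alpha beta : F,
       vsval x = alpha *: munit e (inord 1) (inord 0)
                 + beta *: munit e (inord 2) (inord 1)}) /\
    fills (symv k X) (fun i => mon_of (@sl_sym F 2 k) (s i)).
Proof.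
move=> EX; have [s sP] := lower_fill.
exists (fun j => nseq (word_len j) (Subvs (lower_sl (s j)))); split.
  by move=> i x /nseqP[-> _]; exists 1, (s i).
apply: sP => j a jd ak p Ep.
pose v i := if (i < a)%N then e`_0 else e`_1.
have -> : p = mon_of (@sl_sym F 2 k)
    (nseq (word_len j) (Subvs (lower_sl (s j))))
    (sym_prod (fun i : 'I_k => v i)).
  apply/val_inj; rewrite val_mon_of_nseq /= -[LHS]/(val p) Ep; congr iter.
  rewrite -(big_mkord xpredT (fun i => lform (v i))).
  rewrite (big_cat_nat (n := a)) //=; congr (_ * _).
    rewrite (eq_big_nat _ _ (F2 := fun=> lform e`_0)) => [|i /andP[_ ia]].
      by rewrite prodr_const_nat subn0.
    by rewrite /v ia.
  rewrite (eq_big_nat _ _ (F2 := fun=> lform e`_1)) => [|i /andP[ai _]].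
    by rewrite prodr_const_nat.
  by rewrite /v ltnNge ai.
apply: subvP (memv_img _ _).
  exact: (sumv_sup (Ordinal jd)).
apply: mem_symv => i; rewrite EX /v.
by case: ifP => _; apply: memv_span; rewrite !inE eqxx ?orbT.
Qed.
End Filling.

Lemma extend_plane_basis (F : fieldType) (X : {vspace 'cV[F]_3}) :
  \dim X = 2%N ->
  exists2 e : 3.-tuple 'cV[F]_3,
    basis_of fullv e & X = <<[:: e`_0; e`_1]>>%VS.
Proof.
move=> dX; pose s := vbasis X ++ vbasis X^C.
have ss : size s == 3%N.
  by rewrite size_cat !size_tuple dimv_compl dX dimvf.
exists (Tuple ss) => /=.
  rewrite -(addv_complf X); apply: cat_basis; try exact: vbasisP.
  by apply/directv_addP; rewrite capv_compl.
rewrite -[LHS](span_basis (vbasisP X)) /s.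
have := size_tuple (vbasis X); rewrite [RHS]dX.
by case: (tval _) => [|u [|v []]].
Qed.

(** * The diameter *)

Theorem theorem8p1 (R : realType) (k : nat) (hk : (1 <= k)%N)
    (X : {vspace 'cV[R[i]]_3}) (hX : \dim X = 2%N) :
  let rho := @sl_sym R[i] 2 k in
  let U := symv k X in
  let d := uphalf (k + 2) in
  mon_diam_is rho U d /\
  (forall e : 3.-tuple 'cV[R[i]]_3,
     basis_of fullv e -> X = <<[:: e`_0; e`_1]>>%VS ->
     exists s : 'I_d -> seq (subvs_of (sl R[i] 3)),
       (forall i, {in s i, forall x, exists alpha beta : R[i],
          vsval x = alpha *: munit e (inord 1) (inord 0)
                    + beta *: munit e (inord 2) (inord 1)}) /\
       fills U (fun i => mon_of rho (s i))).
Proof.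
move=> rho U d; split; last by move=> e be EX; exact: lower_monomials_fill.
split; last by move=> d' [m [_ fm]]; exact: (leq_dim_fills hX fm).
have [e be EX] := extend_plane_basis hX.
have [s [_ sf]] := lower_monomials_fill k be EX.
by exists (fun i => mon_of rho (s i)); split=> // i; exists (s i).
Qed.
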